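(* Let $0<q<1$, $0<a<1$, $0<b<1$, $c>0$, $\mathcal X=\mathbb Z_{\ge0}$, and define for $x,y\in\mathcal X$ $$K(x,y)=\sum_{z=0}^{\min(x,y)}\pi'(x,z)\,\pi_{qH}(z,y,a,b),\qquad \pi'(x,z)=\frac{(-b^{-1}c;q)_z(b;q)_{x-z}(b^{-1}c)^{x-z}q^{\binom x2-\binom z2}}{(-c;q)_x(q;q)_{x-z}}\frac{(-c;q)_\infty}{(-b^{-1}c;q)_\infty}.$$ Then $K(x,y)\ge0$, $\sum_{x\in\mathcal X}K(x,y)=1$, and with $\pi(x)=\pi_{qM}(x,abq^{-1},(ab)^{-1}c)$ and $\check P_n(x)=\check P_{qM,n}(x,abq^{-1},(ab)^{-1}c)$, for all $x,y,n\in\mathcal X$, $$K(x,y)\,\pi(y)=K(y,x)\,\pi(x),\qquad \sum_{y\in\mathcal X}K(x,y)\,\pi(y)\,\check P_n(y)=\kappa(n)\,\pi(x)\,\check P_n(x),\qquad \kappa(n)=\frac{(a;q)_n}{(ab;q)_n}.$$ Moreover, the functions $v_n(x)=(-1)^x\frac{q^{\binom x2}}{(q;q)_x}\,\check P_{qM,n}(x,-cq^{-1},abc^{-1})$ form another set of eigenvectors: $\sum_{y\in\mathcal X}K(x,y)v_n(y)=\kappa^{(-)}(n)\,v_n(x)$ for all $n,x\in\mathcal X$, with $$\kappa^{(-)}(n)=\frac{(a;q)_\infty(-c;q)_\infty}{(ab;q)_\infty(-b^{-1}c;q)_\infty}\,\frac{(-b^{-1}c;q)_n}{(-c;q)_n},$$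 and $0<\kappa^{(-)}(n)<1$, $0<\kappa^{(-)}(n)/\kappa(n)<1$.
   Context: $(a;q)_n=\prod_{i=0}^{n-1}(1-aq^i)$, $(a;q)_\infty=\prod_{i\ge0}(1-aq^i)$. $q$-Hahn measure ($0<a<1$, $b<1$, integers $0\le z\le y$): $\pi_{qH}(z,y,a,b)=\frac{(q;q)_y}{(q;q)_z(q;q)_{y-z}}\frac{(a;q)_z(b;q)_{y-z}a^{y-z}}{(ab;q)_y}$. $q$-Meixner measure ($0<\beta<q^{-1}$, $\gamma>0$, $x\in\mathbb Z_{\ge0}$): $\pi_{qM}(x,\beta,\gamma)=\frac{(\beta q;q)_x}{(q;q)_x(-\beta\gamma q;q)_x}\gamma^xq^{\binom x2}\frac{(-\beta\gamma q;q)_\infty}{(-\gamma;q)_\infty}$. The functions $\check P_{qM,n}(x,\beta,\gamma)=\sum_{k=0}^{n}\frac{(q^{-n};q)_k(q^{-x};q)_k}{(\beta q;q)_k(q;q)_k}(-\gamma^{-1}q^{n+1})^k$ are defined by the same formula also for negative $\beta$. *)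

(* Defs.v *)
From HB Require Import structures.
From mathcomp Require Import all_boot all_order all_algebra.
From mathcomp Require Import all_classical all_reals all_analysis.

Set Implicit Arguments.
Unset Strict Implicit.
Unset Printing Implicit Defensive.

Import Order.TTheory GRing.Theory Num.Theory.
Import numFieldNormedType.Exports.

Local Open Scope classical_set_scope.
Local Open Scope ring_scope.

(* (a; q)_n *)
Definition qpoch (R : realType) (a q : R) (n : nat) : R :=
  \prod_(i < n) (1 - a * q ^+ i).

(* (a; q)_oo *)
Definition qpoch_inf (R : realType) (a q : R) : R :=
  lim (qpoch a q n @[n --> \oo]).

(* The q-Hahn weight of z on {0, ..., y}; y - z is truncated, so the value is
   meaningful only for z <= y. *)
Definition pi_qH (R : realType) (q : R) (z y : nat) (a b : R) : R :=
  qpoch q q y / (qpoch q q z * qpoch q q (y - z)) *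
  (qpoch a q z * qpoch b q (y - z) * a ^+ (y - z) / qpoch (a * b) q y).

Definition pi_qM (R : realType) (q : R) (x : nat) (beta gamma : R) : R :=
  qpoch (beta * q) q x / (qpoch q q x * qpoch (- (beta * gamma * q)) q x) *
  gamma ^+ x * q ^+ 'C(x, 2) *
  (qpoch_inf (- (beta * gamma * q)) q / qpoch_inf (- gamma) q).

Definition P_qM (R : realType) (q : R) (n x : nat) (beta gamma : R) : R :=
  \sum_(0 <= k < n.+1)
    qpoch (q ^- n) q k * qpoch (q ^- x) q k /
    (qpoch (beta * q) q k * qpoch q q k) *
    (- (gamma^-1 * q ^+ n.+1)) ^+ k.

(* pi'(x, z), meaningful only for z <= x; the exponent of q is an integer
   difference. *)
Definition pi_prime (R : realType) (q b c : R) (x z : nat) : R :=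
  qpoch (- (b^-1 * c)) q z * qpoch b q (x - z) * (b^-1 * c) ^+ (x - z) *
  q ^ ('C(x, 2)%:Z - 'C(z, 2)%:Z) /
  (qpoch (- c) q x * qpoch q q (x - z)) *
  (qpoch_inf (- c) q / qpoch_inf (- (b^-1 * c)) q).

Definition kernelK (R : realType) (q a b c : R) (x y : nat) : R :=
  \sum_(0 <= z < (minn x y).+1) pi_prime q b c x z * pi_qH q z y a b.

Definition pi_stat (R : realType) (q a b c : R) (x : nat) : R :=
  pi_qM q x (a * b * q^-1) ((a * b)^-1 * c).

Definition P_check (R : realType) (q a b c : R) (n x : nat) : R :=
  P_qM q n x (a * b * q^-1) ((a * b)^-1 * c).

Definition kappa (R : realType) (q a b : R) (n : nat) : R :=
  qpoch a q n / qpoch (a * b) q n.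

Definition v_minus (R : realType) (q a b c : R) (n x : nat) : R :=
  (-1) ^+ x * (q ^+ 'C(x, 2) / qpoch q q x) *
  P_qM q n x (- (c * q^-1)) (a * b * c^-1).

Definition kappa_minus (R : realType) (q a b c : R) (n : nat) : R :=
  qpoch_inf a q * qpoch_inf (- c) q /
    (qpoch_inf (a * b) q * qpoch_inf (- (b^-1 * c)) q) *
  (qpoch (- (b^-1 * c)) q n / qpoch (- c) q n).

(* Main.v *)
(** One has [pi_qH(z, y) pi(y) = s(z) pi'(y, z)] for a function [s] of [z] alone, so
detailed balance holds already for each fixed [z]. By balance the spectral identity becomes [sum_y K(y, x) P_n(y) = kappa(n) P_n(x)].
The polynomial with parameter [a b] is carried by [pi_prime] to [kappa(n)] times
the one with parameter [a] (same [gamma]), and [pi_qH] carries the latter back.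
The [pi_qH] step acts diagonally on [(q^-y; q)_k], by the q-Chu-Vandermonde sum;
the [pi_prime] step acts diagonally on [(- q^(1-y) / c; q)_k], by the 1phi1 sum,
and Heine's transformation of the terminating 2phi1 rewrites [P_n] in that second
basis. The substitution [(a, c) -> (- c / b, - a b)] swaps the two factors of the
kernel up to conjugation by [(-1)^x q^binom(x, 2) / (q; q)_x], which gives the
second family of eigenvectors; normalization of [K] is the case [n = 0]. *)

Require Import Defs.
From HB Require Import structures.
From mathcomp Require Import all_boot all_order all_algebra.
From mathcomp Require Import all_classical all_reals all_analysis.
From mathcomp Require Import ring lra zify.

Set Implicit Arguments.
Unset Strict Implicit.
Unset Printing Implicit Defensive.

Import Order.TTheory GRing.Theory Num.Theory.
Import numFieldNormedType.Exports.

Local Open Scope classical_set_scope.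
Local Open Scope ring_scope.

(** * q-binomial sums *)

Section QBinomial.
Variables (R : realType) (q : R).

Lemma qpoch0 a : qpoch a q 0 = 1.
Proof. by rewrite /qpoch big_ord0. Qed.

Lemma qpochSr a n : qpoch a q n.+1 = qpoch a q n * (1 - a * q ^+ n).
Proof. by rewrite /qpoch big_ord_recr. Qed.

Lemma qpochS a n : qpoch a q n.+1 = (1 - a) * qpoch (a * q) q n.
Proof.
rewrite /qpoch big_ord_recl expr0 mulr1; congr (_ * _).
by apply: eq_bigr => i _; rewrite exprS mulrA.
Qed.

Lemma qpochD a m n : qpoch a q (m + n) = qpoch a q m * qpoch (a * q ^+ m) q n.
Proof.
elim: n => [|n IHn]; first by rewrite addn0 qpoch0 mulr1.
by rewrite addnS !qpochSr IHn exprD !mulrA.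
Qed.

Hypotheses (q_gt0 : 0 < q) (q_lt1 : q < 1).

Lemma mulrX_lt1 x n : x < 1 -> x * q ^+ n < 1.
Proof.
move=> x1; have [x0|x0] := leP x 0.
  by rewrite (le_lt_trans _ ltr01) // mulr_le0_ge0 // exprn_ge0 // ltW.
by rewrite (le_lt_trans _ x1) // ler_piMr ?(ltW x0) // exprn_ile1 // ltW.
Qed.

Lemma qpoch_gt0 a n : a < 1 -> 0 < qpoch a q n.
Proof.
by move=> a1; apply: prodr_gt0 => i _; rewrite subr_gt0 mulrX_lt1.
Qed.

Lemma qpoch_neq0 a n : a < 1 -> qpoch a q n != 0.
Proof. by move=> a1; rewrite gt_eqF // qpoch_gt0. Qed.

Lemma subr1X_neq0 n : 1 - q ^+ n.+1 != 0.
Proof. by rewrite subr_eq0 gt_eqF // exprn_ilt1 // ltW. Qed.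

(** Zero for [k > n], so that [qbinomS] and [mul_qbinom_absorb] hold for every [k]. *)
Definition qbinom n k : R :=
  if (k <= n)%N then qpoch q q n / (qpoch q q k * qpoch q q (n - k)) else 0.

Lemma qbinomE m k :
  qbinom (m + k) k = qpoch q q (m + k) / (qpoch q q k * qpoch q q m).
Proof. by rewrite /qbinom leq_addl addnK. Qed.

Lemma qbinom0 n : qbinom n 0 = 1.
Proof. by rewrite -{1}[n]addn0 qbinomE addn0 qpoch0 mul1r divff ?qpoch_neq0. Qed.

Lemma qbinom_small n k : (n < k)%N -> qbinom n k = 0.
Proof. by rewrite /qbinom ltnNge => /negbTE->. Qed.

Lemma qbinomS n k : qbinom n.+1 k.+1 = q ^+ k.+1 * qbinom n k.+1 + qbinom n k.
Proof.
have [kn|nk] := leqP k n; last by rewrite !qbinom_small ?mulr0 ?addr0 // ltnW.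
rewrite -(subnK kn); set m := (n - k)%N.
(* For [m = 0] the term [qbinom n k.+1] lies outside the triangle, and [qbinomE] does not apply to
   it. *)
rewrite -addnS !qbinomE; case: m => [|m].
  rewrite qbinom_small ?add0n // mulr0 add0r !qpoch0 !mulr1.
  by rewrite !divff ?qpoch_neq0.
rewrite (addSnnS m k) qbinomE !addnS !addSn !qpochSr -!exprS !exprS exprD.
move: (subr1X_neq0 m) (subr1X_neq0 k) (qpoch_neq0 k q_lt1) (qpoch_neq0 m q_lt1).
rewrite !exprS => *; field; by repeat (apply/andP; split).
Qed.

Lemma qbinomSr n k : (k <= n)%N ->
  qbinom n.+1 k.+1 = qbinom n k.+1 + q ^+ (n - k) * qbinom n k.
Proof.
move=> kn.
rewrite -(subnK kn); set m := (n - k)%N; rewrite addnK.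
rewrite -addnS !qbinomE; case: m => [|m].
  rewrite qbinom_small ?add0n // expr0 add0r mul1r !qpoch0 !mulr1.
  by rewrite !divff ?qpoch_neq0.
rewrite (addSnnS m k) qbinomE !addnS !addSn !qpochSr -!exprS !exprS exprD.
move: (subr1X_neq0 m) (subr1X_neq0 k) (qpoch_neq0 k q_lt1) (qpoch_neq0 m q_lt1).
rewrite !exprS => *; field; by repeat (apply/andP; split).
Qed.

Lemma mul_qbinom_absorb n k :
  qbinom n.+1 k.+1 * (1 - q ^+ k.+1) = (1 - q ^+ n.+1) * qbinom n k.
Proof.
have [kn|nk] := leqP k n; last by rewrite !qbinom_small ?mulr0 ?mul0r // ltnW.
rewrite -(subnK kn); set m := (n - k)%N.
rewrite -addnS !qbinomE addnS !qpochSr -!exprS.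
move: (subr1X_neq0 k) (qpoch_neq0 k q_lt1) (qpoch_neq0 m q_lt1).
rewrite !exprS => *; field; by repeat (apply/andP; split).
Qed.

(** Pascal's rule integrated against a weight: inductions on [n] for q-binomial sums then reduce to
    comparing weights term by term. *)
Lemma sum_qbinomS n (f : nat -> R) :
  \sum_(k < n.+2) qbinom n.+1 k * f k =
  \sum_(k < n.+1) qbinom n k * (q ^+ k * f k + f k.+1).
Proof.
rewrite big_ord_recl /= qbinom0.
under eq_bigr do rewrite /bump add1n qbinomS mulrDl.
rewrite big_split /= addrA.
under [RHS]eq_bigr do rewrite mulrDr.
rewrite big_split /=; congr (_ + _).
rewrite big_ord_recr /= [qbinom n n.+1]qbinom_small // mulr0 mul0r addr0.
rewrite [RHS]big_ord_recl /= qbinom0 expr0 !mul1r; congr (_ + _).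
by apply: eq_bigr => i _; rewrite /bump /= add1n mulrA [qbinom _ _ * _]mulrC.
Qed.

Lemma sum_qbinomSr n (f : nat -> R) :
  \sum_(k < n.+2) qbinom n.+1 k * f k =
  \sum_(k < n.+1) qbinom n k * (f k + q ^+ (n - k) * f k.+1).
Proof.
rewrite big_ord_recl /= qbinom0.
under eq_bigr => i _ do rewrite /bump add1n (@qbinomSr n i (ltn_ord i)) mulrDl.
rewrite big_split /= addrA.
under [RHS]eq_bigr do rewrite mulrDr.
rewrite big_split /=; congr (_ + _).
  rewrite big_ord_recr /= [qbinom n n.+1]qbinom_small // mul0r addr0.
  by rewrite [RHS]big_ord_recl /= qbinom0.
by apply: eq_bigr => i _; rewrite mulrA [qbinom _ _ * _]mulrC.
Qed.

(** The q-analogue of [k binom(n, k) = n binom(n-1, k-1)]: the factor [1 - q^k] kills the term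
    [k = 0] and lowers [n]. *)
Lemma sum_qbinom_absorb n (f : nat -> R) :
  \sum_(k < n.+2) qbinom n.+1 k * ((1 - q ^+ k) * f k) =
  (1 - q ^+ n.+1) * \sum_(k < n.+1) qbinom n k * f k.+1.
Proof.
rewrite big_ord_recl /= expr0 subrr mul0r mulr0 add0r mulr_sumr.
by apply: eq_bigr => i _; rewrite /bump add1n !mulrA mul_qbinom_absorb.
Qed.

(** A form of the q-Chu-Vandermonde sum, which normalizes the q-Hahn weights. After Pascal's rule
    each term gains the same factor, [(1 - a q^(n-i)) + a q^(n-i) (1 - b q^i) = 1 - a b q^n]. *)
Lemma qHahn_sum a b n :
  \sum_(k < n.+1) qbinom n k * (qpoch b q k * a ^+ k * qpoch a q (n - k)) =
  qpoch (a * b) q n.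
Proof.
elim: n => [|n IHn].
  by rewrite big_ord1 qbinom0 !qpoch0 !mulr1.
rewrite (sum_qbinomSr n (fun k => qpoch b q k * a ^+ k * qpoch a q (n.+1 - k))).
rewrite qpochSr -IHn mulr_suml; apply: eq_bigr => i _.
have le_in : (i <= n)%N by rewrite -ltnS.
rewrite subSn // subSS !qpochSr exprS.
have -> : q ^+ n = q ^+ (n - i) * q ^+ i by rewrite -exprD subnK.
by ring.
Qed.

(** The finite version of the 1phi1 sum. Pascal's rule produces the common factor
    [(1 - b w q^i) - w (1 - b q^i) = 1 - w] and replaces [w] by [w q], hence the induction for all
    [w]. *)
Lemma qbinom_1phi1_sum b w n :
  \sum_(k < n.+1) qbinom n k *
     (qpoch b q k * (- w) ^+ k * q ^+ 'C(k, 2) * qpoch (b * w * q ^+ k) q (n - k)) =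
  qpoch w q n.
Proof.
elim: n w => [|n IHn] w.
  by rewrite big_ord1 qbinom0 !qpoch0 !mulr1.
rewrite (sum_qbinomS n (fun k => qpoch b q k * (- w) ^+ k * q ^+ 'C(k, 2) *
  qpoch (b * w * q ^+ k) q (n.+1 - k))).
rewrite qpochS -IHn mulr_sumr; apply: eq_bigr => i _.
have le_in : (i <= n)%N by rewrite -ltnS.
rewrite subSn // subSS (qpochSr b) qpochS binS bin1 exprD !exprS.
rewrite -[- (w * q)]mulNr exprMn.
have -> : b * w * q ^+ i * q = b * (w * q) * q ^+ i by ring.
have -> : b * w * (q * q ^+ i) = b * (w * q) * q ^+ i by ring.
by ring.
Qed.

End QBinomial.

(** * Heine's transformation *)

Section Heine.
Variables (R : realType) (q : R).

(** The homogeneous form of [B^k (D / B; q)_k], free of division by [B]. *)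
Definition qprod B D k : R := \prod_(i < k) (B - D * q ^+ i).

Lemma qprod0 B D : qprod B D 0 = 1.
Proof. by rewrite /qprod big_ord0. Qed.

Lemma qprodSr B D k : qprod B D k.+1 = qprod B D k * (B - D * q ^+ k).
Proof. by rewrite /qprod big_ord_recr. Qed.

Lemma qprodS B D k : qprod B D k.+1 = (B - D) * qprod B (q * D) k.
Proof.
rewrite /qprod big_ord_recl expr0 mulr1; congr (_ * _).
by apply: eq_bigr => i _; rewrite exprS mulrA [D * q]mulrC.
Qed.

Lemma qprodZ s B D k : qprod (s * B) (s * D) k = s ^+ k * qprod B D k.
Proof.
elim: k => [|k IHk]; first by rewrite !qprod0 mulr1.
by rewrite !qprodSr IHk exprSr; ring.
Qed.

Lemma qpoch_qprod B X k : qpoch X q k * B ^+ k = qprod B (B * X) k.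
Proof.
elim: k => [|k IHk]; first by rewrite qpoch0 qprod0 mulr1.
by rewrite qpochSr qprodSr -IHk exprSr; ring.
Qed.

Hypotheses (q_gt0 : 0 < q) (q_lt1 : q < 1).

(** This is [(A; q)_n] times the terminating 2phi1 with upper parameters [q^-n], [D / B], lower
    parameter [A] and argument [B q^n], denominators cleared. Heine's transformation becomes its
    symmetry in [A] and [B]. *)
Definition heine_sum n A B D : R :=
  \sum_(k < n.+1) qbinom q n k *
    ((- 1) ^+ k * q ^+ 'C(k, 2) * qprod B D k * qpoch (A * q ^+ k) q (n - k)).

Lemma heine_sum0 A B D : heine_sum 0 A B D = 1.
Proof. by rewrite /heine_sum big_ord1 qbinom0 // qprod0 qpoch0 !mulr1. Qed.

(** Pascal's rule, after which the leading factor [1 - A q^i] is expanded and the powers of [q^i]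
    are absorbed into [qprod] by homogeneity. *)
Lemma heine_sumS n A B D :
  heine_sum n.+1 A B D =
  heine_sum n (q * A) (q * B) (q * D) -
  A * heine_sum n (q * A) (q ^+ 2 * B) (q ^+ 2 * D) -
  (B - D) * heine_sum n (q * A) (q * B) (q ^+ 2 * D).
Proof.
rewrite /heine_sum (sum_qbinomS q_gt0 q_lt1 n (fun k => (- 1) ^+ k *
  q ^+ 'C(k, 2) * qprod B D k * qpoch (A * q ^+ k) q (n.+1 - k))).
rewrite !mulr_sumr -!sumrB; apply: eq_bigr => i _.
have le_in : (i <= n)%N by rewrite -ltnS.
have -> : q ^+ 2 * D = q * (q * D) by ring.
rewrite !qprodZ.
have -> : qprod (q ^+ 2 * B) (q * (q * D)) i = q ^+ i * q ^+ i * qprod B D i.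
  by rewrite mulrA -expr2 qprodZ -exprM mulnC exprM expr2.
rewrite subSn // subSS qpochS qprodS binS bin1 exprD !exprS.
have -> : A * q ^+ i * q = q * A * q ^+ i by ring.
have -> : A * (q * q ^+ i) = q * A * q ^+ i by ring.
by ring.
Qed.

Lemma heine_sum_scaleB n A B D :
  heine_sum n.+1 A B D - heine_sum n.+1 A (q * B) D =
  - (B * (1 - q ^+ n.+1) * heine_sum n (q * A) (q * B) (q * D)).
Proof.
(* The q-difference of [qprod] in [B]; the value of [k.-1] at [k = 0] is harmless because
   [1 - q^0 = 0]. *)
have E k : (1 - q ^+ k) * (B * qprod B D k.-1) = qprod B D k - qprod (q * B) D k.
  case: k => [|k] /=; first by rewrite expr0 subrr mul0r !qprod0 subrr.
  rewrite qprodSr; have -> : qprod (q * B) D k.+1 = (q * B - D) * q ^+ k * qprod B D k.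
    by rewrite qprodS qprodZ mulrA.
  by rewrite exprS; ring.
rewrite /heine_sum -sumrB.
under eq_bigr => i _.
  rewrite -mulrBr.
  rewrite (_ : _ - _ = (1 - q ^+ i) * ((- 1) ^+ i * q ^+ 'C(i, 2) *
    (B * qprod B D i.-1) * qpoch (A * q ^+ i) q (n.+1 - i))); last first.
    by rewrite -mulrBl -mulrBr -E; ring.
  over.
rewrite (sum_qbinom_absorb q_gt0 q_lt1 n (fun i => (- 1) ^+ i * q ^+ 'C(i, 2) *
    (B * qprod B D i.-1) * qpoch (A * q ^+ i) q (n.+1 - i))).
rewrite -mulrA mulrCA -mulrN; congr (_ * _).
rewrite mulr_sumr -sumrN; apply: eq_bigr => i _ /=.
rewrite subSS qprodZ binS bin1 exprD !exprS.
have -> : A * (q * q ^+ i) = q * A * q ^+ i by ring.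
by ring.
Qed.

(* The symmetric recursion combines [heine_sumS] with [heine_sum_scaleB],
   eliminating the only term in which A and B are scaled differently. *)
Lemma heine_sumSS n A B D :
  heine_sum n.+2 A B D =
  heine_sum n.+1 (q * A) (q * B) (q * D) -
  (A + B - D) * heine_sum n.+1 (q * A) (q * B) (q ^+ 2 * D) -
  q * (A * B) * (1 - q ^+ n.+1) *
    heine_sum n (q ^+ 2 * A) (q ^+ 2 * B) (q ^+ 3 * D).
Proof.
rewrite heine_sumS.
have := heine_sum_scaleB n (q * A) (q * B) (q ^+ 2 * D).
have -> : q * (q * A) = q ^+ 2 * A by ring.
have -> : q * (q * B) = q ^+ 2 * B by ring.
have -> : q * (q ^+ 2 * D) = q ^+ 3 * D by ring.
move=> /eqP; rewrite subr_eq => /eqP E.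
have {E}E : heine_sum n.+1 (q * A) (q ^+ 2 * B) (q ^+ 2 * D) =
  heine_sum n.+1 (q * A) (q * B) (q ^+ 2 * D) + q * B * (1 - q ^+ n.+1) *
  heine_sum n (q ^+ 2 * A) (q ^+ 2 * B) (q ^+ 3 * D).
  by rewrite E; ring.
by rewrite E; ring.
Qed.

(** The recursion [heine_sumSS] is symmetric in [A] and [B]; being of order two, it needs the base
    cases [n = 0] and [n = 1]. *)
Lemma heine_sumC n A B D : heine_sum n A B D = heine_sum n B A D.
Proof.
elim/ltn_ind: n A B D => -[_|[_|n IHn]] A B D; first by rewrite !heine_sum0.
  by rewrite !heine_sumS !heine_sum0; ring.
rewrite !heine_sumSS (IHn n.+1) // (IHn n.+1 _ (q * A) _ (q ^+ 2 * D)) //.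
by rewrite (IHn n) ?(addrC A) ?(mulrC A) // ltnW.
Qed.

(** Factor by factor, [q^n (1 - q^(k-n)) = - q^k (1 - q^(n-k))]; this links 2phi1 terms to those of
    [heine_sum]. *)
Lemma qpoch_invX_qbinom n k : (k <= n)%N ->
  qpoch (q ^- n) q k * (q ^+ n) ^+ k / qpoch q q k =
  (- 1) ^+ k * q ^+ 'C(k, 2) * qbinom q n k.
Proof.
have q0 : q != 0 by rewrite gt_eqF.
elim: k => [|k IHk] kn.
  by rewrite qpoch0 expr0 qbinom0 // qpoch0 expr0 divr1 !mulr1.
have := IHk (ltnW kn).
have q1 := subr1X_neq0 q_gt0 q_lt1 k.
have qk0 := qpoch_neq0 q_gt0 q_lt1 k q_lt1.
have E : qbinom q n k.+1 * (1 - q ^+ k.+1) = qbinom q n k * (1 - q ^+ (n - k)).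
  rewrite -(subnK kn) -{2 3}addSnnS; set m := (n - k.+1)%N.
  rewrite addnK addSnnS !qbinomE -[in RHS]addSnnS qbinomE addSnnS.
  have := subr1X_neq0 q_gt0 q_lt1 m.
  have := qpoch_neq0 q_gt0 q_lt1 m q_lt1.
  rewrite !qpochSr -!exprS => qm0 q2; field.
  by repeat (apply/andP; split).
rewrite !qpochSr -!exprS binS bin1 exprD.
have -> : qbinom q n k.+1 = qbinom q n k * (1 - q ^+ (n - k)) / (1 - q ^+ k.+1).
  by rewrite -E mulfK.
move=> IH.
have -> : qpoch (q ^- n) q k * (1 - q ^- n * q ^+ k) * (q ^+ n) ^+ k.+1 /
  (qpoch q q k * (1 - q ^+ k.+1)) = (qpoch (q ^- n) q k * (q ^+ n) ^+ k / qpoch q q k)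
  * (q ^+ n * (1 - q ^- n * q ^+ k) / (1 - q ^+ k.+1)).
  by rewrite exprS; field; rewrite expf_neq0 // q1.
rewrite IH.
have -> : q ^+ n * (1 - q ^- n * q ^+ k) = - (q ^+ k * (1 - q ^+ (n - k))).
  rewrite mulrBr mulrA divff ?expf_neq0 // mulrBr -exprD subnKC ?(ltnW kn) //.
  by ring.
by rewrite [(-1) ^+ k.+1]exprS; ring.
Qed.

Lemma heine_transform n C u X :
  (forall k, qpoch C q k != 0) -> (forall k, qpoch (C * u) q k != 0) ->
  \sum_(0 <= k < n.+1)
    qpoch (q ^- n) q k * qpoch X q k / (qpoch C q k * qpoch q q k) *
    (C * u * q ^+ n) ^+ k =
  qpoch (C * u) q n / qpoch C q n *
  \sum_(0 <= k < n.+1)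
    qpoch (q ^- n) q k * qpoch (u * X) q k /
    (qpoch (C * u) q k * qpoch q q k) * (C * q ^+ n) ^+ k.
Proof.
move=> C0 Cu0.
have key A B Y : (forall k, qpoch A q k != 0) ->
  qpoch A q n * \sum_(0 <= k < n.+1)
    qpoch (q ^- n) q k * qpoch Y q k / (qpoch A q k * qpoch q q k) *
    (B * q ^+ n) ^+ k = heine_sum n A B (B * Y).
  move=> A0; rewrite big_mkord mulr_sumr; apply: eq_bigr => i _.
  have le_in : (i <= n)%N by rewrite -ltnS.
  have := qpoch_invX_qbinom le_in.
  rewrite -qpoch_qprod.
  rewrite (_ : qbinom q n i * _ = (-1) ^+ i * q ^+ 'C(i, 2) * qbinom q n i *
    (qpoch Y q i * B ^+ i) * qpoch (A * q ^+ i) q (n - i)); last by ring.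
  move=> <-; rewrite -[in qpoch A q n](subnKC le_in) qpochD exprMn.
  by have := qpoch_neq0 q_gt0 q_lt1 i q_lt1; have := A0 i => *; field; apply/andP.
(* Since [(C u) X = C (u X)], the two series are [heine_sum] with the same [D] and with [C], [C u]
   exchanged. *)
have E1 := key _ (C * u) X C0.
have E2 := key _ C (u * X) Cu0.
rewrite heine_sumC mulrA -E1 in E2.
by rewrite [RHS]mulrAC E2 [RHS]mulrAC divff // mul1r.
Qed.

End Heine.

(** * Infinite q-Pochhammer symbols and the 1phi1 sum *)

Section QPochInf.
Variables (R : realType) (q : R).
Hypotheses (q_gt0 : 0 < q) (q_lt1 : q < 1).

Lemma nondecreasing_qpoch a : a <= 0 -> nondecreasing_seq (qpoch a q).
Proof.
move=> a0; apply/nondecreasing_seqP => n.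
have a1 : a < 1 by rewrite (le_lt_trans a0).
rewrite qpochSr ler_peMr ?(ltW (qpoch_gt0 _ _ _ _)) //.
by rewrite lerBrDr gerDl mulr_le0_ge0 // exprn_ge0 // ltW.
Qed.

Lemma qpoch_le_expR a n : a <= 0 -> qpoch a q n <= expR (- a / (1 - q)).
Proof.
move=> a0; have q1 : 0 < 1 - q by rewrite subr_gt0.
(* The induction uses [1 + x <= exp x] and needs the partial geometric sum in the exponent. *)
suff H : qpoch a q n <= expR (- a * (1 - q ^+ n) / (1 - q)).
  rewrite (le_trans H) // ler_expR ler_pM2r ?invr_gt0 //.
  by rewrite ler_piMr ?oppr_ge0 // gerBl exprn_ge0 // ltW.
elim: n => [|n IHn]; first by rewrite qpoch0 expr0 subrr mulr0 mul0r expR0.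
rewrite qpochSr.
have -> : - a * (1 - q ^+ n.+1) / (1 - q) =
  - a * (1 - q ^+ n) / (1 - q) + - (a * q ^+ n).
  by rewrite exprS; field; rewrite gt_eqF.
have an0 : 0 <= - (a * q ^+ n).
  by rewrite oppr_ge0 mulr_le0_ge0 // exprn_ge0 // ltW.
rewrite expRD ler_pM //; first by rewrite ltW // qpoch_gt0 // (le_lt_trans a0).
  by rewrite addr_ge0.
exact: expR_ge1Dx.
Qed.

(** For [a < 1] the sequence is monotone and bounded; in general, finitely many factors are split
    off until [a q^N < 1]. *)
Lemma is_cvg_qpoch a : cvgn (qpoch a q).
Proof.
have cvg_lt1 x : x < 1 -> cvgn (qpoch x q).
  move=> x1; have [x0|x0] := leP x 0.
    apply: nondecreasing_is_cvgn; first exact: nondecreasing_qpoch.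
    by exists (expR (- x / (1 - q))) => _ [n _ <-]; exact: qpoch_le_expR.
  apply: nonincreasing_is_cvgn.
    apply/nonincreasing_seqP => n.
    rewrite qpochSr ler_piMr ?(ltW (qpoch_gt0 _ _ _ _)) //.
    by rewrite gerBl mulr_ge0 ?exprn_ge0 // ltW.
  by exists 0 => _ [n _ <-]; rewrite ltW // qpoch_gt0.
have qn1 : `|q| < 1 by rewrite gtr0_norm.
have : (a * q ^+ n @[n --> \oo] --> a * 0) by apply: cvgMl_tmp; exact: cvg_expr.
rewrite mulr0 => /cvgr_lt /(_ 1 ltr01) [N _ /(_ N (leqnn N)) /= aN].
have /cvg_ex[l Hl] := cvg_lt1 _ aN.
apply/cvg_ex; exists (qpoch a q N * l).
rewrite -(cvg_shiftn N) /=.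
under eq_fun do rewrite addnC qpochD.
exact: cvgMl_tmp.
Qed.

Lemma cvg_qpoch a : qpoch a q @ \oo --> qpoch_inf a q.
Proof. exact: is_cvg_qpoch. Qed.

Lemma qpoch_infD a n : qpoch_inf a q = qpoch a q n * qpoch_inf (a * q ^+ n) q.
Proof.
apply/esym; have := @cvg_qpoch a; rewrite -(cvg_shiftn n) /=.
under eq_fun do rewrite addnC qpochD.
have H : qpoch a q n * qpoch (a * q ^+ n) q m @[m --> \oo] -->
  qpoch a q n * qpoch_inf (a * q ^+ n) q by apply: cvgMl_tmp; exact: cvg_qpoch.
by move=> H'; apply: (cvg_unique _ H H').
Qed.

Lemma qpoch_infS a : qpoch_inf a q = (1 - a) * qpoch_inf (a * q) q.
Proof. by rewrite (qpoch_infD a 1) qpochSr qpoch0 !expr0 mulr1 mul1r expr1. Qed.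

Lemma qpoch_le_inf a n : a <= 0 -> qpoch a q n <= qpoch_inf a q.
Proof.
by move=> a0; apply: nondecreasing_cvgn_le; [exact: nondecreasing_qpoch|exact: is_cvg_qpoch].
Qed.

(** For [0 < a < 1] only nonvanishing is at stake: the partial products are bounded below by the
    inverses of those at [- a / (1 - a)], which converge. *)
Lemma qpoch_inf_gt0 a : a < 1 -> 0 < qpoch_inf a q.
Proof.
move=> a1; have [a0|a0] := leP a 0.
  by apply: lt_le_trans (qpoch_le_inf 0 a0); rewrite qpoch0.
have a1' : 0 < 1 - a by rewrite subr_gt0.
(* (1 - t) (1 + t / (1 - a)) >= 1 for 0 <= t <= a *)
have H n : 1 <= qpoch a q n * qpoch (- (a / (1 - a))) q n.
  elim: n => [|n IHn]; first by rewrite !qpoch0 mulr1.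
  rewrite !qpochSr mulrACA (le_trans IHn) // ler_peMr ?(le_trans ler01) //.
  have t0 : 0 <= a * q ^+ n by rewrite mulr_ge0 ?exprn_ge0 // ltW.
  have ta : a * q ^+ n <= a by rewrite ler_piMr ?(ltW a0) // exprn_ile1 // ltW.
  have -> : - (a / (1 - a)) * q ^+ n = - (a * q ^+ n / (1 - a)) by ring.
  rewrite opprK -subr_ge0; set t := a * q ^+ n in t0 ta *.
  have -> : (1 - t) * (1 + t / (1 - a)) - 1 = t * (a - t) / (1 - a).
    by field; rewrite gt_eqF.
  by apply: divr_ge0; [apply: mulr_ge0; rewrite ?subr_ge0|exact: ltW].
have L : 1 <= qpoch_inf a q * qpoch_inf (- (a / (1 - a))) q.
  apply: (cvgr_to_ge (cvgM (@cvg_qpoch a) (@cvg_qpoch (- (a / (1 - a)))))).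
  by near=> n; exact: H.
rewrite lt_neqAle; apply/andP; split.
  by apply/eqP => E; move: L; rewrite -E mul0r leNgt ltr01.
apply: (cvgr_to_ge (@cvg_qpoch a)); near=> n; exact/ltW/qpoch_gt0.
Unshelve. all: by end_near. Qed.

Lemma qpoch_inf_neq0 a : a < 1 -> qpoch_inf a q != 0.
Proof. by move=> a1; rewrite gt_eqF // qpoch_inf_gt0. Qed.

Lemma le_qpoch x y n : x <= y -> y < 1 -> qpoch y q n <= qpoch x q n.
Proof.
move=> xy y1; elim: n => [|n IHn]; first by rewrite !qpoch0.
have qn0 : 0 <= q ^+ n by rewrite exprn_ge0 // ltW.
rewrite !qpochSr ler_pM ?(ltW (qpoch_gt0 _ _ _ _)) //.
  by rewrite subr_ge0 ltW // mulrX_lt1.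
by rewrite lerD2l lerN2 ler_wpM2r.
Qed.

Lemma le_qpoch_inf x y : x <= y -> y < 1 -> qpoch_inf y q <= qpoch_inf x q.
Proof.
move=> xy y1; apply: (ler_cvg_to (@cvg_qpoch y) (@cvg_qpoch x)).
by near=> n; apply: le_qpoch.
Unshelve. all: by end_near. Qed.

(** Strictness is lost in the limit, so it is taken from the first factor, split off beforehand. *)
Lemma lt_qpoch_inf x y : x < y -> y < 1 -> qpoch_inf y q < qpoch_inf x q.
Proof.
move=> xy y1.
have yq1 : y * q < 1 by rewrite -[q in X in X < _]expr1 mulrX_lt1.
have xyq : x * q < y * q by rewrite ltr_pM2r.
rewrite (qpoch_infS y) (qpoch_infS x).
apply: (@le_lt_trans _ _ ((1 - y) * qpoch_inf (x * q) q)).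
  by rewrite ler_pM2l ?subr_gt0 // le_qpoch_inf // ltW.
rewrite ltr_pM2r ?qpoch_inf_gt0 //; last exact: lt_trans yq1.
by rewrite ltrD2l ltrN2.
Qed.

Lemma normr_qpoch_le a n : `|qpoch a q n| <= qpoch_inf (- `|a|) q.
Proof.
apply: le_trans (qpoch_le_inf n _); last by rewrite oppr_le0.
rewrite /qpoch normr_prod; apply: ler_prod => i _; rewrite normr_ge0 /=.
by rewrite (le_trans (ler_normB _ _)) // normr1 normrM mulNr opprK
  (ger0_norm (exprn_ge0 _ (ltW q_gt0))).
Qed.

Lemma qpoch_inf_le a n : 0 <= a -> a < 1 -> qpoch_inf a q <= qpoch a q n.
Proof.
move=> a0 a1; apply: nonincreasing_cvgn_ge; last exact: is_cvg_qpoch.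
apply/nonincreasing_seqP => k.
rewrite qpochSr ler_piMr ?(ltW (qpoch_gt0 _ _ _ _)) //.
by rewrite gerBl mulr_ge0 ?exprn_ge0 // ltW.
Qed.

Lemma is_cvg_series_gauss (w : R) :
  cvgn (series (fun k => `|w| ^+ k * q ^+ 'C(k, 2))).
Proof.
set m := fun k : nat => `|w| ^+ k * q ^+ 'C(k, 2).
have m0 k : 0 <= m k by rewrite mulr_ge0 // exprn_ge0 // ltW.
have mS k : m k.+1 = m k * (`|w| * q ^+ k).
  by rewrite /m binS bin1 exprD exprS; ring.
have qn1 : `|q| < 1 by rewrite gtr0_norm.
have : (`|w| * q ^+ n @[n --> \oo] --> `|w| * 0) by apply: cvgMl_tmp; exact: cvg_expr.
have h0 : 0 < 2^-1 :> R by rewrite invr_gt0.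
rewrite mulr0 => /cvgr_lt /(_ _ h0) [N _ HN].
have step k : m (N + k).+1%N <= m (N + k)%N / 2.
  by rewrite mS ler_wpM2l // ltW //; apply: (HN (N + k)%N); exact: leq_addr.
(* Once the ratio of consecutive terms is at most 1/2, partial sum plus twice the next term is
   nonincreasing. *)
have bnd k : series m (N + k)%N + 2 * m (N + k)%N <= series m N + 2 * m N.
  elim: k => [|k IHk]; first by rewrite addn0.
  rewrite (le_trans _ IHk) // addnS seriesSr /=; have := step k.
  lra.
apply: nondecreasing_is_cvgn; first by apply: nondecreasing_series.
exists (series m N + 2 * m N) => _ [n _ <-].
apply: le_trans (bnd n).
rewrite -[X in X <= _]addr0; apply: lerD; last exact: mulr_ge0.
by apply: (nondecreasing_series (fun k _ _ => m0 k)) => //; exact: leq_addl.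
Qed.

End QPochInf.

(** * Dominated convergence for series *)

Lemma cvg_sumr (R : realType) (I : Type) (s : seq I) (f : I -> nat -> R) (l : I -> R) :
  (forall i, f i n @[n --> \oo] --> l i) ->
  \sum_(i <- s) f i n @[n --> \oo] --> \sum_(i <- s) l i.
Proof.
by move=> fl; apply: cvg_big => [|i _]; [exact: add_continuous|exact: fl].
Qed.

(** [M] also dominates the limits [l], so beyond a fixed [N] the two series differ by at most twice
    a tail of [M], while the first [N] terms converge one by one. *)
Lemma tannery (R : realType) (u : nat -> nat -> R) (l M : nat -> R) (L : R) :
  (forall k, u n k @[n --> \oo] --> l k) -> (forall n k, `|u n k| <= M k) ->
  cvgn (series M) -> series (u n) n.+1 @[n --> \oo] --> L ->
  series l @ \oo --> L.
Proof.
move=> ul uM cM uL.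
have M0 k : 0 <= M k by apply: le_trans (uM 0%N k).
have lM k : `|l k| <= M k.
  by apply: (cvgr_to_le (cvg_norm (ul k))); near=> n.
rewrite -cvg_shiftS.
have D0 : (fun n => series (u n) n.+1 - series l n.+1) @ \oo --> (0 : R).
  apply/cvgr0Pnorm_lt => e e0.
  have e4 : 0 < e / 4 by rewrite divr_gt0.
  have e2 : 0 < e / 2 by rewrite divr_gt0.
  have ndM : nondecreasing_seq (series M) by apply: nondecreasing_series.
  have [N _ HN] := (cvgrPdist_lt _ _).1 cM _ e4.
  have tail n : (N <= n)%N -> \sum_(N <= k < n) M k <= e / 4.
    move=> Nn; rewrite -sub_series_geq //.
    have := HN N (leqnn N); rewrite /= ger0_norm; last first.
      by rewrite subr_ge0; exact: nondecreasing_cvgn_le.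
    move=> H; rewrite ltW // (le_lt_trans _ H) // lerD2r.
    exact: nondecreasing_cvgn_le.
  have F0 : \sum_(k <- index_iota 0 N) (u n k - l k) @[n --> \oo] -->
      \sum_(k <- index_iota 0 N) (l k - l k).
    by apply: cvg_sumr => k; apply: cvgB; [exact: ul|exact: cvg_cst].
  rewrite [X in _ --> X]big1 in F0; last by move=> i _; rewrite subrr.
  have {F0}F1 := (cvgr0Pnorm_lt _).1 F0 _ e2.
  near=> n.
  have Nn : (N <= n.+1)%N by near: n; exists N => // n /= /leqW.
  rewrite /series /= -sumrB (big_cat_nat (leq0n N) Nn) /=.
  rewrite (le_lt_trans (ler_normD _ _)) // [e]splitr ltr_leD //.
    by near: n; exact: F1.
  rewrite (le_trans (ler_norm_sum _ _ _)) //.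
  rewrite (@le_trans _ _ (\sum_(N <= k < n.+1) 2 * M k)) //.
    apply: ler_sum => k _; rewrite (le_trans (ler_normB _ _)) //.
    by have := uM n k; have := lM k; lra.
  by rewrite -mulr_sumr; have := tail _ Nn; lra.
have H := cvgB uL D0; rewrite subr0 in H.
suff -> : [sequence series l n.+1]_n =
  (fun n => series (u n) n.+1) - (fun n => series (u n) n.+1 - series l n.+1).
  exact: H.
by apply/funext => n /=; rewrite fctE subKr.
Unshelve. all: by end_near. Qed.

(** * The 1phi1 summation theorem *)

Section Sum1phi1.
Variables (R : realType) (q : R).
Hypotheses (q_gt0 : 0 < q) (q_lt1 : q < 1).

Definition term1phi1 (b w : R) (k : nat) : R :=
  qpoch b q k * (- w) ^+ k * q ^+ 'C(k, 2) * qpoch_inf (b * w * q ^+ k) q /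
  qpoch q q k.

(* The 1phi1 summation theorem; the denominator parameter b w is multiplied out,
   so that it may take the values q^-m. *)
Lemma sum_1phi1 b w : series (term1phi1 b w) @ \oo --> qpoch_inf w q.
Proof.
(* The three factors bound the q-binomial coefficient, [(b; q)_k] and [(b w q^k; q)_(n-k)],
   uniformly in [n] and [k]. *)
pose c0 := (qpoch_inf q q)^-1 ^+ 2 * qpoch_inf (- `|b|) q * qpoch_inf (- `|b * w|) q.
have qi0 := qpoch_inf_gt0 q_gt0 q_lt1 q_lt1.
have Ng0 x : 0 <= qpoch_inf (- `|x : R|) q.
  by rewrite ltW // qpoch_inf_gt0 // (le_lt_trans _ ltr01) // oppr_le0.
(* The limit [n -> oo] of [qbinom_1phi1_sum]. *)
apply: (@tannery _ (fun n k => qbinom q n k * (qpoch b q k * (- w) ^+ k *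
   q ^+ 'C(k, 2) * qpoch (b * w * q ^+ k) q (n - k))) _
   (fun k => c0 * (`|w| ^+ k * q ^+ 'C(k, 2)))).
- move=> k; rewrite -(cvg_shiftn k) /=.
  under eq_fun do rewrite addnK qbinomE.
  (* The factor [1 / (q; q)_k] is rewritten as the quotient of the limits of numerator and
     denominator of the q-binomial coefficient. *)
  have -> : term1phi1 b w k = (qpoch_inf q q / (qpoch q q k * qpoch_inf q q)) *
      (qpoch b q k * (- w) ^+ k * q ^+ 'C(k, 2) * qpoch_inf (b * w * q ^+ k) q).
    rewrite /term1phi1; field.
    by rewrite (gt_eqF qi0) qpoch_neq0.
  apply: cvgM; last by apply: cvgMl_tmp; exact: cvg_qpoch.
  apply: cvgM.
    have := cvg_qpoch q_gt0 q_lt1 (a := q).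
    by rewrite -(cvg_shiftn k).
  apply: cvgV; first by rewrite mulf_neq0 ?qpoch_neq0 // gt_eqF.
  by apply: cvgMl_tmp; exact: cvg_qpoch.
- move=> n k.
  have [kn|nk] := leqP k n; last first.
    rewrite qbinom_small // mul0r normr0.
    apply: mulr_ge0; last by rewrite mulr_ge0 ?exprn_ge0 // ltW.
    apply: mulr_ge0; last exact: Ng0.
    apply: mulr_ge0; last exact: Ng0.
    by rewrite exprn_ge0 // invr_ge0 ltW.
  rewrite !normrM normrX normrN (ger0_norm (exprn_ge0 _ (ltW q_gt0))).
  have qb : `|qbinom q n k| <= (qpoch_inf q q)^-1 ^+ 2.
    have Eb : qbinom q n k = qpoch q q n * ((qpoch q q k)^-1 * (qpoch q q (n - k))^-1).
      by rewrite /qbinom kn invfM.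
    have qq m : 0 < qpoch q q m by exact: qpoch_gt0.
    have iq m : (qpoch q q m)^-1 <= (qpoch_inf q q)^-1.
      by rewrite lef_pV2 ?posrE // qpoch_inf_le // ltW.
    rewrite Eb ger0_norm; last by rewrite !mulr_ge0 ?invr_ge0 ?(ltW (qq _)).
    rewrite -[leRHS]mul1r ler_pM ?mulr_ge0 ?invr_ge0 ?(ltW (qq _)) //.
      rewrite (_ : 1 = qpoch 0 q n) ?le_qpoch ?(ltW q_gt0) //.
      by rewrite /qpoch big1 // => i _; rewrite mul0r subr0.
    by rewrite expr2 ler_pM ?invr_ge0 ?(ltW (qq _)).
  have bb := normr_qpoch_le q_gt0 q_lt1 b k.
  have bw : `|qpoch (b * w * q ^+ k) q (n - k)| <= qpoch_inf (- `|b * w|) q.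
    rewrite (le_trans (normr_qpoch_le q_gt0 q_lt1 _ _)) // le_qpoch_inf //.
      rewrite lerN2 normrM ler_piMr // ger0_norm ?exprn_ge0 ?(ltW q_gt0) //.
      by rewrite exprn_ile1 // ltW.
  rewrite (_ : `|qbinom q n k| * _ = `|qbinom q n k| * `|qpoch b q k| *
    `|qpoch (b * w * q ^+ k) q (n - k)| * (`|w| ^+ k * q ^+ 'C(k, 2))); last by ring.
  rewrite /c0 ler_wpM2r ?mulr_ge0 ?exprn_ge0 ?(ltW q_gt0) //.
  by rewrite !ler_pM ?mulr_ge0.
- by apply: is_cvg_seriesZ; exact: is_cvg_series_gauss.
- under eq_fun do rewrite /series /= big_mkord qbinom_1phi1_sum //.
  exact: cvg_qpoch.
Qed.

End Sum1phi1.

(** * Action of the two factors on the q-Meixner polynomials *)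

Section SeriesTools.
Variable R : realType.
Implicit Types (f : nat -> R) (l c : R).

Lemma cvg_seriesMl f l c :
  series f @ \oo --> l -> series (fun i => c * f i) @ \oo --> c * l.
Proof.
move=> fl; rewrite (_ : series (fun i => c * f i) = fun n => c * series f n).
  exact: cvgMl_tmp.
by apply/funext => n; rewrite /series /= mulr_sumr.
Qed.

Lemma cvg_series_sumr (I : Type) (s : seq I) (f : I -> nat -> R) (l : I -> R) :
  (forall i, series (f i) @ \oo --> l i) ->
  series (fun n => \sum_(i <- s) f i n) @ \oo --> \sum_(i <- s) l i.
Proof.
move=> fl; rewrite (_ : series _ = fun n => \sum_(i <- s) series (f i) n).
  exact: cvg_sumr.
by apply/funext => n; rewrite /series /= exchange_big.
Qed.

Lemma cvg_series_shift z f l : series f @ \oo --> l ->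
  series (fun y => if (z <= y)%N then f (y - z)%N else 0) @ \oo --> l.
Proof.
move=> fl; rewrite -(cvg_shiftn z).
suff -> : [sequence series (fun y => if (z <= y)%N then f (y - z)%N else 0)
  (n + z)%N]_n = series f by [].
apply/funext => n /=; rewrite /series /= (big_cat_nat (leq0n z) (leq_addl n z)) /=.
rewrite big_nat big1 ?add0r => [|i /andP[_ iz]]; last by rewrite leqNgt iz.
rewrite -{1}[z]add0n big_addn addnK.
by apply: eq_bigr => i _; rewrite leq_addl addnK.
Qed.

End SeriesTools.

Section Intertwining.
Variables (R : realType) (q : R).
Hypotheses (q_gt0 : 0 < q) (q_lt1 : q < 1).

Let q0 : q != 0. Proof. by rewrite gt_eqF. Qed.
Let qn0 n : q ^+ n != 0. Proof. by rewrite expf_neq0. Qed.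

(** The extra factor is [- q / (b w q^i)] times [1 - b w q^(i-1)]; the latter extends the infinite
    product to the left, and [q^-i] turns [w^i] into [(w / q)^i]. *)
Lemma term1phi1_shift b w i : b != 0 -> w != 0 ->
  term1phi1 q b w i * (1 - q / (b * w) / q ^+ i) =
  - (q / (b * w)) * term1phi1 q b (w / q) i.
Proof.
move=> b0 w0; rewrite /term1phi1.
rewrite [qpoch_inf (b * (w / q) * _) q]qpoch_infS //.
have -> : b * (w / q) * q ^+ i * q = b * w * q ^+ i by field.
have -> : (- (w / q)) ^+ i = (- w) ^+ i / q ^+ i by rewrite -mulNr exprMn exprVn.
have := qpoch_neq0 q_gt0 q_lt1 i q_lt1; have := qn0 i => *; field.
by repeat (apply/andP; split).
Qed.

(** Each factor of the Pochhammer symbol is removed at the price of [w -> w / q], down to the plain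
    1phi1 sum. *)
Lemma sum_1phi1_qpoch k b w : b != 0 -> w != 0 ->
  series (fun i => term1phi1 q b w i * qpoch (q / (b * w) / q ^+ i) q k) @ \oo -->
  b ^- k * qpoch (q / w) q k * qpoch_inf w q.
Proof.
move=> b0; elim: k w => [|k IHk] w w0.
  under eq_fun do rewrite qpoch0 mulr1.
  by rewrite expr0 invr1 qpoch0 !mul1r; exact: sum_1phi1.
have wq0 : w / q != 0 by rewrite mulf_neq0 ?invr_eq0.
have -> : b ^- k.+1 * qpoch (q / w) q k.+1 * qpoch_inf w q =
  - (q / (b * w)) *
  (b ^- k * qpoch (q / (w / q)) q k * qpoch_inf (w / q) q).
  rewrite qpochS [qpoch_inf (w / q) q]qpoch_infS // divfK //.
  have -> : q / (w / q) = q / w * q by field; rewrite q0 w0.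
  have := expf_neq0 k b0 => bk0.
  by rewrite exprS; field; repeat (apply/andP; split).
rewrite (_ : (fun i => _) = fun i => - (q / (b * w)) *
  (term1phi1 q b (w / q) i * qpoch (q / (b * (w / q)) / q ^+ i) q k)).
  by apply: cvg_seriesMl; exact: IHk.
apply/funext => i; rewrite qpochS.
have -> : q / (b * w) / q ^+ i * q = q / (b * (w / q)) / q ^+ i.
  by have := qn0 i => ?; field; repeat (apply/andP; split).
have := term1phi1_shift i b0 w0.
by move: (term1phi1 q b w i) (term1phi1 q b (w / q) i) => T T' E; rewrite [LHS]mulrA E [RHS]mulrA.
Qed.

Lemma bin2D z i : 'C(z + i, 2) = ('C(z, 2) + 'C(i, 2) + z * i)%N.
Proof.
elim: i => [|i IHi]; first by rewrite addn0 bin0n muln0 !addn0.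
by rewrite addnS !binS !bin1 IHi mulnS; lia.
Qed.

(** Column [z] of [pi_prime] is a 1phi1 series with [w = - c q^z / b], divided by its sum. *)
Lemma pi_prime_term1phi1 b c z i :
  b != 0 -> - c < 1 -> - (b^-1 * c) < 1 ->
  pi_prime q b c (z + i) z =
  term1phi1 q b (- (b^-1 * c) * q ^+ z) i / qpoch_inf (- (b^-1 * c) * q ^+ z) q.
Proof.
move=> b0 c1 bc1; rewrite /pi_prime /term1phi1 addKn.
have -> : q ^ ('C(z + i, 2)%:Z - 'C(z, 2)%:Z) = q ^+ 'C(i, 2) * (q ^+ z) ^+ i.
  by rewrite bin2D -addnA PoszD addrC addKr -exprnP exprD exprM.
rewrite (qpoch_infD q_gt0 q_lt1 (- c) (z + i)).
rewrite (qpoch_infD q_gt0 q_lt1 (- (b^-1 * c)) z).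
have -> : - c * q ^+ (z + i) = b * (- (b^-1 * c) * q ^+ z) * q ^+ i.
  by rewrite exprD; field.
have -> : - (- (b^-1 * c) * q ^+ z) = b^-1 * c * q ^+ z by ring.
rewrite [(b^-1 * c * q ^+ z) ^+ i]exprMn.
have H1 := qpoch_neq0 q_gt0 q_lt1 (z + i) c1.
have H2 := qpoch_neq0 q_gt0 q_lt1 z bc1.
have H3 := qpoch_neq0 q_gt0 q_lt1 i q_lt1.
have H4 := qpoch_inf_neq0 q_gt0 q_lt1 bc1.
rewrite (qpoch_infD q_gt0 q_lt1 _ z) mulf_eq0 negb_or in H4.
case/andP: H4 => _ H4; have := expf_neq0 i b0 => H5.
by field; repeat (apply/andP; split).
Qed.

(** Heine's transformation with [u = - q / (g C)], chosen so that [C u q^n] is the argument in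
    [P_qM]; the new basis is the one of [sum_1phi1_qpoch]. *)
Lemma P_qM_heine n y C g : C != 0 -> g != 0 ->
  (forall k, qpoch C q k != 0) -> (forall k, qpoch (- (q / g)) q k != 0) ->
  P_qM q n y (C * q^-1) g =
  qpoch (- (q / g)) q n / qpoch C q n *
  \sum_(0 <= k < n.+1)
    qpoch (q ^- n) q k * qpoch (- (q / g) / C * q ^- y) q k /
    (qpoch (- (q / g)) q k * qpoch q q k) * (C * q ^+ n) ^+ k.
Proof.
move=> C0 g0 HC Hg; rewrite /P_qM divfK //.
have E : C * (- (q / g) / C) = - (q / g) by field; rewrite g0.
have := @heine_transform _ q q_gt0 q_lt1 n C (- (q / g) / C) (q ^- y) HC.
rewrite E => /(_ Hg) <-.
by apply: eq_bigr => k _; congr (_ * _ ^+ _); rewrite exprS; ring.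
Qed.

Lemma sum_pi_prime_P_qM n z a b c :
  a != 0 -> b != 0 -> c != 0 -> a < 1 -> a * b < 1 -> - c < 1 ->
  - (b^-1 * c) < 1 -> - (q / ((a * b)^-1 * c)) < 1 ->
  series (fun y => if (z <= y)%N then
    pi_prime q b c y z * P_qM q n y (a * b * q^-1) ((a * b)^-1 * c) else 0) @ \oo -->
  kappa q a b n * P_qM q n z (a * q^-1) ((a * b)^-1 * c).
Proof.
move=> a0 b0 c0 a1 ab1 c1 bc1; set g := (a * b)^-1 * c => g1.
have ab0 : a * b != 0 by rewrite mulf_neq0.
have g0 : g != 0 by rewrite mulf_neq0 ?invr_eq0.
have nz := qpoch_neq0 q_gt0 q_lt1.
pose w := - (b^-1 * c) * q ^+ z.
have w0 : w != 0 by rewrite mulf_neq0 ?oppr_eq0 ?mulf_neq0 ?invr_eq0.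
have iw0 : qpoch_inf w q != 0.
  have := qpoch_inf_neq0 q_gt0 q_lt1 bc1.
  by rewrite (qpoch_infD q_gt0 q_lt1 _ z) mulf_eq0 negb_or => /andP[].
(* The part of the expansion of [P_qM] that is independent of [y], over the normalization of
   [pi_prime]. The factor [b^-k] from the 1phi1 sum turns [(a b)^k] into [a^k], and [kappa] accounts
   for the change of prefactor. *)
pose coef k := qpoch (- (q / g)) q n / qpoch (a * b) q n *
  (qpoch (q ^- n) q k / (qpoch (- (q / g)) q k * qpoch q q k) *
  (a * b * q ^+ n) ^+ k) / qpoch_inf w q.
have -> : kappa q a b n * P_qM q n z (a * q^-1) g =
  \sum_(k <- index_iota 0 n.+1) coef k * (b ^- k * qpoch (q / w) q k * qpoch_inf w q).
  rewrite P_qM_heine // => [|k|k]; rewrite ?nz //.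
  rewrite /kappa !mulr_sumr; apply: eq_bigr => k _; rewrite /coef.
  have -> : - (q / g) / a * q ^- z = q / w.
    by rewrite /g /w; field; rewrite a0 b0 c0 qn0.
  rewrite ![(_ * q ^+ n) ^+ k]exprMn [(a * b) ^+ k]exprMn.
  have := expf_neq0 k b0.
  have := nz _ n a1; have := nz _ n ab1; have := nz _ k q_lt1; have := nz _ k g1.
  by move=> *; field; repeat (apply/andP; split).
have step : series (fun i => \sum_(k <- index_iota 0 n.+1)
    coef k * (term1phi1 q b w i * qpoch (q / (b * w) / q ^+ i) q k)) @ \oo -->
  \sum_(k <- index_iota 0 n.+1) coef k * (b ^- k * qpoch (q / w) q k * qpoch_inf w q).
  by apply: cvg_series_sumr => k; apply: cvg_seriesMl; exact: sum_1phi1_qpoch.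
have := cvg_series_shift z step.
set F := (X in series X @ _ --> _) => HF.
set G := (X in series X @ _ --> _).
suff -> : G = F by [].
apply/funext => y; rewrite /G /F; case: leqP => // zy.
rewrite -{1 2}(subnKC zy); set i := (y - z)%N.
rewrite pi_prime_term1phi1 // -/w P_qM_heine // => [|k|k]; rewrite ?nz //.
rewrite !mulr_sumr; apply: eq_bigr => k _; rewrite /coef.
have -> : - (q / g) / (a * b) * q ^- (z + i) = q / (b * w) / q ^+ i.
  by rewrite /g /w exprD; field; rewrite a0 b0 c0 !qn0.
by ring.
Qed.

(** Induction on [k]: the factor [1 - q^-z] is absorbed into the q-binomial, lowering [x] and [z]
    and replacing [a] by [a q]. The case [k = 0] is [qHahn_sum] in reversed order. *)
Lemma qHahn_moment_mul k x a b :
  (\sum_(z < x.+1) qbinom q x z *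
     (qpoch b q (x - z) * a ^+ (x - z) * qpoch a q z) * qpoch (q ^- z) q k) *
  qpoch (a * b) q k = qpoch (a * b) q x * qpoch a q k * qpoch (q ^- x) q k.
Proof.
elim: k x a => [|k IHk] x a.
  rewrite !qpoch0 !mulr1 -qHahn_sum //.
  rewrite (reindex_inj rev_ord_inj) /=; apply: eq_bigr => i _.
  have ix : (i <= x)%N by rewrite -ltnS.
  rewrite qpoch0 mulr1 subSS subKn //; congr (_ * _).
  by rewrite /qbinom leq_subr ix subKn // [qpoch q q i * _]mulrC.
(* For [x = 0] both sides contain the factor [1 - q^0 = 0]. *)
case: x => [|x].
  by rewrite big_ord1 !qpochS expr0 invr1 subrr !mul0r !mulr0 mul0r.
rewrite (eq_bigr (fun z : 'I_x.+2 => qbinom q x.+1 z * ((1 - q ^+ z) *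
   (- (q ^- z) * (qpoch b q (x.+1 - z) * a ^+ (x.+1 - z) * qpoch a q z) *
     qpoch (q ^- z * q) q k)))); last first.
  move=> z _; rewrite qpochS.
  have -> : 1 - q ^- z = (1 - q ^+ z) * - (q ^- z).
    by rewrite mulrN mulrBl mul1r divff // opprB.
  by ring.
rewrite (sum_qbinom_absorb q_gt0 q_lt1 x (fun z => - (q ^- z) *
  (qpoch b q (x.+1 - z) * a ^+ (x.+1 - z) * qpoch a q z) *
     qpoch (q ^- z * q) q k)) /=.
have := IHk x (a * q).
set S := (X in X * _ = _ -> _) => ES.
set S' := \sum_(z < _) _.
have -> : S' = - (q ^- x.+1) * (1 - a) * S.
  rewrite mulr_sumr; apply: eq_bigr => z _.
  have zx : (z <= x)%N by rewrite -ltnS.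
  rewrite subSS qpochS.
  have -> : q ^- z.+1 * q = q ^- z by rewrite exprS; field; rewrite q0 qn0.
  (* The power [q^(x-z)] split off here turns [a^(x-z)] into [(a q)^(x-z)]. *)
  have -> : q ^- z.+1 = q ^- x.+1 * q ^+ (x - z).
    have -> : q ^+ x.+1 = q ^+ z.+1 * q ^+ (x - z) by rewrite -exprD addSn subnKC.
    by field; rewrite !qn0.
  by rewrite [(a * q) ^+ _]exprMn; ring.
rewrite [qpoch (a * b) q k.+1]qpochS [qpoch (a * b) q x.+1]qpochS.
rewrite [qpoch a q k.+1]qpochS [qpoch (q ^- x.+1) q k.+1]qpochS.
have -> : q ^- x.+1 * q = q ^- x by rewrite exprS; field; rewrite q0 qn0.
have -> : a * b * q = a * q * b by ring.
have -> : (1 - q ^+ x.+1) * (- q ^- x.+1 * (1 - a) * S) *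
  ((1 - a * b) * qpoch (a * q * b) q k) = (1 - q ^+ x.+1) * - q ^- x.+1 * (1 - a) *
  (1 - a * b) * (S * qpoch (a * q * b) q k) by ring.
rewrite ES mulrN mulrBl mul1r divff // opprB.
by ring.
Qed.

Lemma pi_qH_qbinom z y a b : (z <= y)%N ->
  pi_qH q z y a b = qbinom q y z *
     (qpoch b q (y - z) * a ^+ (y - z) * qpoch a q z) / qpoch (a * b) q y.
Proof. by move=> zy; rewrite /pi_qH /qbinom zy; ring. Qed.

(** Averaging [(q^-z; q)_k] yields [(a; q)_k / (a b; q)_k] times [(q^-x; q)_k], which exchanges the
    lower parameter [a] for [a b]. *)
Lemma sum_pi_qH_P_qM n x a b g : a < 1 -> a * b < 1 ->
  \sum_(0 <= z < x.+1) pi_qH q z x a b * P_qM q n z (a * q^-1) g =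
  P_qM q n x (a * b * q^-1) g.
Proof.
move=> a1 ab1; have nz := qpoch_neq0 q_gt0 q_lt1.
rewrite /P_qM; under eq_bigr do rewrite mulr_sumr.
rewrite exchange_big /=; apply: eq_bigr => k _.
rewrite !divfK //.
have := qHahn_moment_mul k x a b.
set S := (X in X * _ = _ -> _) => ES.
have {ES}ES : S = qpoch (a * b) q x * qpoch a q k * qpoch (q ^- x) q k / qpoch (a * b) q k.
  by rewrite -ES mulfK // nz.
pose d := qpoch (q ^- n) q k / (qpoch a q k * qpoch q q k) *
  (- (g^-1 * q ^+ n.+1)) ^+ k / qpoch (a * b) q x.
transitivity (d * S).
  rewrite big_mkord /S mulr_sumr; apply: eq_bigr => z _.
  by rewrite pi_qH_qbinom -1?ltnS // /d; ring.
rewrite ES /d.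
have := nz _ k a1; have := nz _ k ab1; have := nz _ k q_lt1; have := nz _ x ab1.
by move=> *; field; repeat (apply/andP; split).
Qed.

(** The range of [z] no longer depends on [x], so the sum over [x] can be taken inside. *)
Lemma kernelK_widen a b c x y :
  kernelK q a b c x y = \sum_(z <- index_iota 0 y.+1)
     pi_qH q z y a b * (if (z <= x)%N then pi_prime q b c x z else 0).
Proof.
rewrite /kernelK (big_nat_widen _ _ y.+1) ?ltnS ?geq_minr //.
rewrite big_mkcond /= big_nat [RHS]big_nat; apply: eq_bigr => z /andP[_].
rewrite !ltnS leq_min => ->; rewrite andbT.
by case: ifP => _; rewrite ?mulr0 // mulrC.
Qed.

(* The parameters are allowed to be negative because the second family of
   eigenvectors is obtained from this lemma by (a, c) -> (- c / b, - a b). *)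
Lemma sum_kernelK_P_check n x a b c :
  a != 0 -> b != 0 -> c != 0 -> a < 1 -> a * b < 1 -> - c < 1 ->
  - (b^-1 * c) < 1 -> - (q / ((a * b)^-1 * c)) < 1 ->
  series (fun y => kernelK q a b c y x * P_check q a b c n y) @ \oo -->
  kappa q a b n * P_check q a b c n x.
Proof.
move=> a0 b0 c0 a1 ab1 c1 bc1 g1; rewrite /P_check.
rewrite -(sum_pi_qH_P_qM n x _ a1 ab1) mulr_sumr.
rewrite (eq_bigr (fun z => pi_qH q z x a b *
  (kappa q a b n * P_qM q n z (a * q^-1) ((a * b)^-1 * c)))); last first.
  by move=> z _; ring.
rewrite (_ : (fun y => _) = fun y => \sum_(z <- index_iota 0 x.+1) pi_qH q z x a b *
  (if (z <= y)%N then
    pi_prime q b c y z * P_qM q n y (a * b * q^-1) ((a * b)^-1 * c) else 0)).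
  by apply: cvg_series_sumr => z; apply: cvg_seriesMl; exact: sum_pi_prime_P_qM.
apply/funext => y; rewrite kernelK_widen mulr_suml; apply: eq_bigr => z _.
by case: leqP => _; rewrite ?mulr0 ?mul0r // mulrA.
Qed.

End Intertwining.

(** * The kernel and its eigenvectors *)

Section Kernel.
Variables (R : realType) (q a b c : R).
Hypotheses (q_gt0 : 0 < q) (q_lt1 : q < 1) (a_gt0 : 0 < a) (a_lt1 : a < 1)
  (b_gt0 : 0 < b) (b_lt1 : b < 1) (c_gt0 : 0 < c).

Let q0 : q != 0. Proof. by rewrite gt_eqF. Qed.
Let a0 : a != 0. Proof. by rewrite gt_eqF. Qed.
Let b0 : b != 0. Proof. by rewrite gt_eqF. Qed.
Let c0 : c != 0. Proof. by rewrite gt_eqF. Qed.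
Let ab_gt0 : 0 < a * b. Proof. exact: mulr_gt0. Qed.
Let ab_lta : a * b < a. Proof. by rewrite gtr_pMr. Qed.
Let ab_lt1 : a * b < 1. Proof. exact: lt_trans ab_lta a_lt1. Qed.
Let c1 : - c < 1. Proof. by rewrite (lt_trans _ ltr01) // oppr_lt0. Qed.
Let bc_gt0 : 0 < b^-1 * c. Proof. by rewrite mulr_gt0 ?invr_gt0. Qed.
Let bc1 : - (b^-1 * c) < 1. Proof. by rewrite (lt_trans _ ltr01) // oppr_lt0. Qed.
Let g_gt0 : 0 < (a * b)^-1 * c. Proof. by rewrite mulr_gt0 ?invr_gt0. Qed.
Let g1 : - ((a * b)^-1 * c) < 1. Proof. by rewrite (lt_trans _ ltr01) // oppr_lt0. Qed.

Lemma pi_prime_ge0 x z : 0 <= pi_prime q b c x z.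
Proof.
rewrite /pi_prime ltW // !(mulr_gt0, divr_gt0) ?exprn_gt0 ?exprz_gt0 //;
  rewrite ?invr_gt0 ?mulr_gt0 ?qpoch_gt0 ?qpoch_inf_gt0 //.
Qed.

Lemma pi_qH_ge0 z y : 0 <= pi_qH q z y a b.
Proof.
by rewrite /pi_qH ltW // !(mulr_gt0, divr_gt0) ?invr_gt0 ?mulr_gt0 ?exprn_gt0 ?qpoch_gt0.
Qed.

Lemma kernelK_ge0 x y : 0 <= kernelK q a b c x y.
Proof. by apply: sumr_ge0 => z _; rewrite mulr_ge0 ?pi_prime_ge0 ?pi_qH_ge0. Qed.

Lemma kernelK_balance x y :
  kernelK q a b c x y * pi_stat q a b c y =
  kernelK q a b c y x * pi_stat q a b c x.
Proof.
(* This is the q-Meixner weight with parameters [a q^-1] and [(a b)^-1 c], the powers of [a]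
   cancelling. *)
pose s z := qpoch a q z * ((a * b)^-1 * c * a^-1) ^+ z * a ^+ z * q ^+ 'C(z, 2) /
  (qpoch q q z * qpoch (- (b^-1 * c)) q z) *
  (qpoch_inf (- (b^-1 * c)) q / qpoch_inf (- ((a * b)^-1 * c)) q).
have E z t : (z <= t)%N ->
    pi_qH q z t a b * pi_stat q a b c t = s z * pi_prime q b c t z.
  move=> zt; rewrite /pi_qH /pi_stat /pi_qM /pi_prime /s -(subnKC zt).
  set i := (t - z)%N; rewrite addKn.
  have -> : - (a * b * q^-1 * ((a * b)^-1 * c) * q) = - c by field; rewrite a0 b0 q0.
  have -> : a * b * q^-1 * q = a * b by rewrite divfK.
  rewrite expfzDr // -exprnP.
  have -> : q ^ (- ('C(z, 2)%:Z)) = q ^- 'C(z, 2) by rewrite -exprnN.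
  have -> : b^-1 * c = a * ((a * b)^-1 * c) by field; rewrite a0 b0.
  set g := (a * b)^-1 * c.
  have nz := qpoch_neq0 q_gt0 q_lt1.
  have inz := qpoch_inf_neq0 q_gt0 q_lt1.
  rewrite [(g * a^-1) ^+ z]exprMn [(a * g) ^+ i]exprMn exprD exprVn.
  have bc1' : - (a * g) < 1.
    by have -> : a * g = b^-1 * c by rewrite /g; field; rewrite a0 b0.
  have H1 := nz _ (z + i)%N ab_lt1; have H2 := nz _ z q_lt1.
  have H3 := nz _ i q_lt1; have H4 := nz _ (z + i)%N q_lt1.
  have H5 := nz _ (z + i)%N c1; have H6 := nz _ z bc1'.
  have H7 := inz _ bc1'; have H8 := inz _ g1; have H9 := inz _ c1.
  have H10 := expf_neq0 z a0; have H11 := expf_neq0 'C(z, 2) q0.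
  by field; repeat (apply/andP; split).
rewrite /kernelK (minnC y) !mulr_suml !big_nat; apply: eq_bigr => z /andP[_].
rewrite ltnS leq_min => /andP[zx zy].
by rewrite -mulrA E // -[RHS]mulrA E //; ring.
Qed.

Lemma sum_kernelK y : series (fun x => kernelK q a b c x y) @ \oo --> (1 : R).
Proof.
have gq1 : - (q / ((a * b)^-1 * c)) < 1.
  by rewrite (lt_trans _ ltr01) // oppr_lt0 divr_gt0.
have P1 x : P_check q a b c 0 x = 1.
  by rewrite /P_check /P_qM big_nat1 !qpoch0 expr0 !mul1r invr1 ?mulr1.
have := @sum_kernelK_P_check _ _ q_gt0 q_lt1 0%N y _ _ _ a0 b0 c0 a_lt1 ab_lt1 c1 bc1 gq1.
rewrite P1 /kappa !qpoch0 divr1 mul1r.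
by under eq_fun do rewrite P1 mulr1.
Qed.

Lemma sum_kernelK_pi_stat x n :
  series (fun y =>
    kernelK q a b c x y * pi_stat q a b c y * P_check q a b c n y) @ \oo -->
  kappa q a b n * pi_stat q a b c x * P_check q a b c n x.
Proof.
have gq1 : - (q / ((a * b)^-1 * c)) < 1.
  by rewrite (lt_trans _ ltr01) // oppr_lt0 divr_gt0.
under eq_fun do rewrite kernelK_balance [_ * pi_stat _ _ _ _ _]mulrC -mulrA.
rewrite [kappa _ _ _ _ * _]mulrC -mulrA.
by apply: cvg_seriesMl; exact: sum_kernelK_P_check.
Qed.

(** Holds for each [z] separately. The constant is the quotient of the two normalizations of
    [pi_prime], [(-c; q)_oo / (-c/b; q)_oo] and [(a b; q)_oo / (a; q)_oo]. *)
Lemma kernelK_swap x y :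
  kernelK q a b c x y * ((-1) ^+ y * (q ^+ 'C(y, 2) / qpoch q q y)) =
  qpoch_inf a q * qpoch_inf (- c) q /
    (qpoch_inf (a * b) q * qpoch_inf (- (b^-1 * c)) q) *
  ((-1) ^+ x * (q ^+ 'C(x, 2) / qpoch q q x)) *
  kernelK q (- (b^-1 * c)) b (- (a * b)) y x.
Proof.
rewrite /kernelK (minnC y) mulr_suml mulr_sumr !big_nat.
apply: eq_bigr => z /andP[_]; rewrite ltnS leq_min => /andP[zx zy].
rewrite /pi_prime /pi_qH -(subnKC zx) -(subnKC zy).
set i := (x - z)%N; set j := (y - z)%N; rewrite !addKn !opprK.
have -> : b^-1 * - (a * b) = - a by field.
have -> : - (b^-1 * c) * b = - c by field.
rewrite opprK !expfzDr // -!exprnP.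
have -> : q ^ (- ('C(z, 2)%:Z)) = q ^- 'C(z, 2) by rewrite -exprnN.
rewrite [(- a) ^+ j]exprNn [(- (b^-1 * c)) ^+ i]exprNn !exprD.
have nz := qpoch_neq0 q_gt0 q_lt1.
have inz := qpoch_inf_neq0 q_gt0 q_lt1.
(* On the right [(-1)^i] occurs twice, from [(-1)^x] and from [(- c / b)^i]; the same square is
   inserted on the left. *)
have S : (-1) ^+ i * (-1) ^+ i = 1 :> R by rewrite -expr2 sqrr_sign.
have H1 := nz _ (z + j)%N ab_lt1; have H2 := nz _ z q_lt1.
have H3 := nz _ i q_lt1; have H4 := nz _ (z + i)%N q_lt1.
have H5 := nz _ (z + i)%N c1; have H6 := nz _ z bc1.
have H7 := inz _ bc1; have H8 := inz _ a_lt1; have H9 := inz _ c1.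
have H10 := inz _ ab_lt1; have H11 := expf_neq0 'C(z, 2) q0.
have H12 := nz _ (z + j)%N q_lt1; have H13 := nz _ j q_lt1.
set bc := b^-1 * c in H6 H7 *.
rewrite -[LHS]mul1r -[X in X * _ = _]S.
by field; repeat (apply/andP; split).
Qed.

Lemma kappa_minusE n :
  kappa_minus q a b c n = qpoch_inf a q * qpoch_inf (- c) q /
    (qpoch_inf (a * b) q * qpoch_inf (- (b^-1 * c)) q) *
  kappa q (- (b^-1 * c)) b n.
Proof.
rewrite /kappa_minus /kappa.
by have -> : - (b^-1 * c) * b = - c by field.
Qed.

Lemma sum_kernelK_v_minus n x :
  series (fun y => kernelK q a b c x y * v_minus q a b c n y) @ \oo -->
  kappa_minus q a b c n * v_minus q a b c n x.
Proof.
pose D := qpoch_inf a q * qpoch_inf (- c) q /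
    (qpoch_inf (a * b) q * qpoch_inf (- (b^-1 * c)) q).
pose h y : R := (-1) ^+ y * (q ^+ 'C(y, 2) / qpoch q q y).
have vE y : v_minus q a b c n y = h y * P_check q (- (b^-1 * c)) b (- (a * b)) n y.
  rewrite /v_minus /P_check -/(h y); congr (_ * P_qM _ _ _ _ _).
    by field; rewrite b0 q0.
  by field; rewrite b0 c0.
under eq_fun do rewrite vE mulrA kernelK_swap -mulrA.
have -> : kappa_minus q a b c n * v_minus q a b c n x = D * h x *
  (kappa q (- (b^-1 * c)) b n * P_check q (- (b^-1 * c)) b (- (a * b)) n x).
  by rewrite kappa_minusE vE -/D; ring.
(* The substitution exchanges the bound on [a] with that on [- c / b], and the bound on [a b] with
   that on [- c]. *)
apply: cvg_seriesMl; apply: sum_kernelK_P_check => //.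
- by rewrite oppr_eq0 gt_eqF.
- by rewrite oppr_eq0 gt_eqF.
- by have -> : - (b^-1 * c) * b = - c by field.
- by rewrite opprK.
- by have -> : - (b^-1 * - (a * b)) = a by field.
- have -> : (- (b^-1 * c) * b)^-1 * - (a * b) = a * b / c by field; rewrite b0 c0.
  by rewrite (lt_trans _ ltr01) // oppr_lt0 !divr_gt0.
Qed.

(** At [x = 0] only the term [k = 0] survives, since [(1; q)_k = 0] for [k > 0]. *)
Lemma v_minus_neq0 n : exists x, v_minus q a b c n x != 0.
Proof.
exists 0%N; rewrite /v_minus bin0n qpoch0 !expr0 divr1 !mul1r /P_qM.
rewrite big_nat_recl // big1 => [|k _].
  by rewrite !qpoch0 expr0 !mul1r invr1 mulr1 addr0 oner_neq0.
by rewrite [qpoch (q ^- 0) q _]qpochS expr0 invr1 subrr !(mul0r, mulr0).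
Qed.

(** Absorbing the finite symbols into tails leaves ratios to which monotonicity of the infinite
    product applies. *)
Lemma kappa_minus_inf n :
  kappa_minus q a b c n = qpoch_inf a q / qpoch_inf (a * b) q *
    (qpoch_inf (- c * q ^+ n) q / qpoch_inf (- (b^-1 * c) * q ^+ n) q).
Proof.
have nz := qpoch_neq0 q_gt0 q_lt1.
have inz := qpoch_inf_neq0 q_gt0 q_lt1.
have H1 := nz _ n c1; have H2 := nz _ n bc1; have H3 := inz _ ab_lt1.
have H4 := inz _ bc1.
rewrite /kappa_minus (qpoch_infD q_gt0 q_lt1 (- c) n).
rewrite (qpoch_infD q_gt0 q_lt1 (- (b^-1 * c)) n) in H4 *.
move: H4; rewrite mulf_eq0 negb_or => /andP[_ H4].
by field; repeat (apply/andP; split).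
Qed.

Lemma qpoch_inf_ratio x y n : x < y -> y < 1 ->
  0 < qpoch_inf (y * q ^+ n) q / qpoch_inf (x * q ^+ n) q < 1.
Proof.
move=> xy y1; have qn := exprn_gt0 n q_gt0.
have inf0 z : z < 1 -> 0 < qpoch_inf (z * q ^+ n) q.
  by move=> z1; rewrite qpoch_inf_gt0 // mulrX_lt1.
have y0 := inf0 _ y1; have x0 := inf0 _ (lt_trans xy y1).
rewrite divr_gt0 //= ltr_pdivrMr // mul1r.
by rewrite lt_qpoch_inf ?mulrX_lt1 // ltr_pM2r.
Qed.

(** Both ratios in [kappa_minus_inf] lie in (0, 1) because [a b < a] and [- c / b < - c]; dividing
    by [kappa] only replaces the first one by its tail from [q^n] on. *)
Lemma kappa_minus_bounds n :
  0 < kappa_minus q a b c n < 1 /\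
  0 < kappa_minus q a b c n / kappa q a b n < 1.
Proof.
have mul01 (x y : R) : 0 < x < 1 -> 0 < y < 1 -> 0 < x * y < 1.
  move=> /andP[x0 x1] /andP[y0 y1]; rewrite mulr_gt0 //=.
  by rewrite (lt_trans _ y1) // gtr_pMl.
have bcc : - (b^-1 * c) < - c by rewrite ltrN2 ltr_pMl // invf_gt1.
have r1 : 0 < qpoch_inf (- c * q ^+ n) q / qpoch_inf (- (b^-1 * c) * q ^+ n) q < 1.
  exact: qpoch_inf_ratio.
have r2 m : 0 < qpoch_inf (a * q ^+ m) q / qpoch_inf (a * b * q ^+ m) q < 1.
  exact: qpoch_inf_ratio.
rewrite kappa_minus_inf; split.
  by apply: mul01 => //; have := r2 0%N; rewrite expr0 !mulr1.
have nz := qpoch_neq0 q_gt0 q_lt1.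
have -> : forall X, qpoch_inf a q / qpoch_inf (a * b) q * X / kappa q a b n =
  qpoch_inf (a * q ^+ n) q / qpoch_inf (a * b * q ^+ n) q * X.
  move=> X; rewrite /kappa (qpoch_infD q_gt0 q_lt1 a n).
  have H1 := nz _ n a_lt1; have H2 := nz _ n ab_lt1.
  have := qpoch_inf_neq0 q_gt0 q_lt1 ab_lt1.
  rewrite (qpoch_infD q_gt0 q_lt1 (a * b) n) mulf_eq0 negb_or => /andP[_ H4].
  by field; repeat (apply/andP; split).
exact: mul01.
Qed.

End Kernel.

Theorem mainTheorem7 (R : realType) (q a b c : R)
  (q_gt0 : 0 < q) (q_lt1 : q < 1) (a_gt0 : 0 < a) (a_lt1 : a < 1)
  (b_gt0 : 0 < b) (b_lt1 : b < 1) (c_gt0 : 0 < c) :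
  (forall x y : nat, 0 <= kernelK q a b c x y) /\
  (forall y : nat,
     series (fun x : nat => kernelK q a b c x y) @ \oo --> (1 : R)) /\
  (forall x y : nat,
     kernelK q a b c x y * pi_stat q a b c y =
     kernelK q a b c y x * pi_stat q a b c x) /\
  (forall x n : nat,
     series (fun y : nat =>
       kernelK q a b c x y * pi_stat q a b c y * P_check q a b c n y) @ \oo -->
     kappa q a b n * pi_stat q a b c x * P_check q a b c n x) /\
  (forall n : nat, exists x : nat, v_minus q a b c n x != 0) /\
  (forall n x : nat,
     series (fun y : nat => kernelK q a b c x y * v_minus q a b c n y) @ \oo -->
     kappa_minus q a b c n * v_minus q a b c n x) /\
  (forall n : nat,
     0 < kappa_minus q a b c n < 1 /\
     0 < kappa_minus q a b c n / kappa q a b n < 1).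
Proof.
split; first by move=> x y; exact: kernelK_ge0.
split; first by move=> y; exact: sum_kernelK.
split; first by move=> x y; exact: kernelK_balance.
split; first by move=> x n; exact: sum_kernelK_pi_stat.
split; first by move=> n; exact: v_minus_neq0.
split; first by move=> n x; exact: sum_kernelK_v_minus.
by move=> n; exact: kappa_minus_bounds.
Qed.
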